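(* Let $\Gamma$ be a set of modal formulas and $A$ a modal formula. (i) If $\Gamma\vdash_{\mathbf K}A$, then $\Gamma\vDash_{\mathbf{bMS}}A$. (ii) If $\Gamma\vdash_{\mathbf D}A$, then $\Gamma\vDash_{\mathbf{bsCoTS}}A$. (iii) If $\Gamma\vdash_{\mathbf T}A$, then $\Gamma\vDash_{\mathbf{bCoTS}}A$. (iv) If $\Gamma\vdash_{\mathbf{K4}}A$, then $\Gamma\vDash_{\mathbf{bsTS}}A$. (v) If $\Gamma\vdash_{\mathbf{KD4}}A$, then $\Gamma\vDash_{\mathbf{bsS}}A$. (vi) If $\Gamma\vdash_{\mathbf{S4}}A$, then $\Gamma\vDash_{\mathbf{bS}}A$.
   Context: A locale $X$ is identified with its frame (complete lattice with finite meets distributing over arbitrary joins). A modal space is a pair $(X,J)$ with $X$ a locale and $J:X\to X$ monotone and preserving all joins; it is boolean if every $a\in X$ has a complement $\neg a$ ($a\wedge\neg a=0$, $a\vee\neg a=1$). Classes of modal spaces: $\mathbf{MS}$: all modal spaces; $\mathbf{sCoTS}$ (semi-cotemporal): $Ja=0$ implies $a=0$; $\mathbf{sTS}$ (semi-temporal): $JJa\le Ja$ for all $a$; $\mathbf{TS}$ (temporal): $Ja\le a$ for all $a$; $\mathbf{CoTS}$ (cotemporal): $a\le Ja$ for all $a$; $\mathbf{sS}=\mathbf{sCoTS}\cap\mathbf{TS}$; $\mathbf{S}=\mathbf{TS}\cap\mathbf{CoTS}$. A prefix $\mathbf b$ on the name of a class denotes its subclass of boolean modal spaces. Modal formulas are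 built from atoms, $\top,\bot$ by $\wedge,\vee,\to,\neg,\Box$. A topological model is $(X,J,V)$ with $(X,J)$ a boolean modal space and $V$ a map from modal formulas to $X$ with $V(\top)=1$, $V(\bot)=0$, $V(A\wedge B)=V(A)\wedge V(B)$, $V(A\vee B)=V(A)\vee V(B)$, $V(A\to B)=\neg V(A)\vee V(B)$, $V(\neg A)=\neg V(A)$, $V(\Box A)=\bigvee\{c\in X: Jc\le V(A)\}$. For a class $\mathcal C$ of boolean modal spaces, $\Gamma\vDash_{\mathcal C}A$ means: for every $(X,J)\in\mathcal C$ and every such $V$, $\bigwedge_{\gamma\in\Gamma}V(\gamma)\le V(A)$. $\mathbf K$ is the modal logic axiomatized by classical tautologies, $\Box(A\to B)\to(\Box A\to\Box B)$, modus ponens and necessitation. $\mathbf D=\mathbf K+\neg\Box\bot$; $\mathbf T=\mathbf K+(\Box A\to A)$; $\mathbf{K4}=\mathbf K+(\Box A\to\Box\Box A)$; $\mathbf{KD4}$ adds both $\neg\Box\bot$ and $\Box A\to\Box\Box A$; $\mathbf{S4}$ adds both $\Box A\to A$ and $\Box A\to\Box\Box A$. $\Gamma\vdash_{\mathbf L}A$ means that $\gamma_1\wedge\dots\wedge\gamma_n\to A$ is a theorem of $\mathbf L$ for some $\gamma_1,\dots,\gamma_n\in\Gamma$. *)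

(* Defs.v *)
From Stdlib Require List.
From HB Require Import structures.
From mathcomp Require Import all_boot all_order.
From mathcomp Require Import all_classical.

Set Implicit Arguments.
Unset Strict Implicit.
Unset Printing Implicit Defensive.

Import Order.TTheory.

Local Open Scope classical_set_scope.
Local Open Scope order_scope.

(* In the presence of [lattice_complete] below these are the actual joins and
   meets of arbitrary subsets; the defaults are the values on the empty set. *)
Definition bigjoin d (X : tbLatticeType d) (A : set X) : X := supremum \bot A.
Definition bigmeet d (X : tbLatticeType d) (A : set X) : X := infimum \top A.

(* Arbitrary meets come for free from arbitrary joins, and binary
   distributivity is an instance of the infinite one. *)
HB.mixin Record TBLattice_isFrame d X of Order.TBLattice d X := {
  lattice_complete : forall A : set X, supremums A !=set0;
  meet_bigjoin : forall (a : X) (A : set X),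
    Order.meet a (bigjoin A) = bigjoin [set Order.meet a b | b in A]
}.

#[short(type="frameType")]
HB.structure Definition Frame d :=
  { X of Order.TBLattice d X & TBLattice_isFrame d X }.

Record modal_space := ModalSpace {
  disp : Order.disp_t;
  locale :> frameType disp;
  J : locale -> locale;
  J_mono : {homo J : a b / a <= b};
  J_bigjoin : forall A : set locale, J (bigjoin A) = bigjoin (J @` A)
}.

Arguments J {m} _.

Definition is_complement d (X : tbLatticeType d) (a b : X) : Prop :=
  Order.meet a b = \bot /\ Order.join a b = \top.

(* The complement of [a] (unique in a frame), if there is one. *)
Definition compl d (X : tbLatticeType d) (a : X) : X :=
  xget \bot [set b | is_complement a b].

Definition boolean (X : modal_space) : Prop :=
  forall a : X, exists b : X, is_complement a b.

Module Spaces.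

Definition MS : set modal_space := setT.
Definition sCoTS : set modal_space :=
  [set X : modal_space | forall a : X, J a = \bot -> a = \bot].
Definition sTS : set modal_space :=
  [set X : modal_space | forall a : X, J (J a) <= J a].
Definition TS : set modal_space :=
  [set X : modal_space | forall a : X, J a <= a].
Definition CoTS : set modal_space :=
  [set X : modal_space | forall a : X, a <= J a].
Definition sS : set modal_space := sCoTS `&` TS.
Definition S : set modal_space := TS `&` CoTS.

Definition bMS := MS `&` boolean.
Definition bsCoTS := sCoTS `&` boolean.
Definition bsTS := sTS `&` boolean.
Definition bCoTS := CoTS `&` boolean.
Definition bsS := sS `&` boolean.
Definition bS := S `&` boolean.

End Spaces.

Inductive formula (atom : Type) : Type :=
| Atom of atom
| Top
| Bot
| And of formula atom & formula atom
| Or of formula atom & formula atom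
| Imp of formula atom & formula atom
| Neg of formula atom
| Box of formula atom.

Arguments Top {atom}.
Arguments Bot {atom}.

Record valuation (atom : Type) (X : modal_space) (V : formula atom -> X) :
    Prop := Valuation {
  V_Top : V Top = \top;
  V_Bot : V Bot = \bot;
  V_And : forall A B, V (And A B) = Order.meet (V A) (V B);
  V_Or : forall A B, V (Or A B) = Order.join (V A) (V B);
  V_Imp : forall A B, V (Imp A B) = Order.join (compl (V A)) (V B);
  V_Neg : forall A, V (Neg A) = compl (V A);
  V_Box : forall A, V (Box A) = bigjoin [set c : X | J c <= V A]
}.

Definition entails (atom : Type) (C : set modal_space)
    (Gamma : set (formula atom)) (A : formula atom) : Prop :=
  forall X : modal_space, C X ->
  forall V : formula atom -> X, valuation V ->
    bigmeet (V @` Gamma) <= V A.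

(* Truth-table evaluation: atoms and boxed formulas are the propositional
   variables, with truth values given by [v]. *)
Fixpoint truth (atom : Type) (v : formula atom -> bool) (A : formula atom) :
    bool :=
  match A with
  | Atom _ | Box _ => v A
  | Top => true
  | Bot => false
  | And B C => truth v B && truth v C
  | Or B C => truth v B || truth v C
  | Imp B C => truth v B ==> truth v C
  | Neg B => ~~ truth v B
  end.

Definition tautology (atom : Type) (A : formula atom) : Prop :=
  forall v : formula atom -> bool, truth v A.

(* Theorems of the extension of K by the axioms [Ax]; in the logics below
   [Ax] is closed under substitution, so no substitution rule is needed. *)
Inductive thm (atom : Type) (Ax : set (formula atom)) : formula atom -> Prop :=
| thm_taut A : tautology A -> thm Ax A
| thm_K A B : thm Ax (Imp (Box (Imp A B)) (Imp (Box A) (Box B)))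
| thm_ax A : Ax A -> thm Ax A
| thm_mp A B : thm Ax (Imp A B) -> thm Ax A -> thm Ax B
| thm_nec A : thm Ax A -> thm Ax (Box A).

Definition axD (atom : Type) : set (formula atom) := [set Neg (Box Bot)].
Definition axT (atom : Type) : set (formula atom) :=
  [set Imp (Box A) A | A in setT].
Definition ax4 (atom : Type) : set (formula atom) :=
  [set Imp (Box A) (Box (Box A)) | A in setT].

Module Logic.

Definition K (atom : Type) : set (formula atom) := thm set0.
Definition D (atom : Type) : set (formula atom) := thm (@axD atom).
Definition T (atom : Type) : set (formula atom) := thm (@axT atom).
Definition K4 (atom : Type) : set (formula atom) := thm (@ax4 atom).
Definition KD4 (atom : Type) : set (formula atom) :=
  thm (@axD atom `|` @ax4 atom).
Definition S4 (atom : Type) : set (formula atom) :=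
  thm (@axT atom `|` @ax4 atom).

End Logic.

(* The empty conjunction is [Top]. *)
Definition conj (atom : Type) (s : seq (formula atom)) : formula atom :=
  if s is A :: s' then foldl (@And atom) A s' else Top.

Definition proves (atom : Type) (L : set (formula atom))
    (Gamma : set (formula atom)) (A : formula atom) : Prop :=
  exists s : seq (formula atom),
    (forall B, List.In B s -> Gamma B) /\ L (Imp (conj s) A).

(* Main.v *)
(** Preservation of joins makes [Box] the right adjoint of [J], that is,
    [J c <= V B] iff [c <= V (Box B)]; every modal axiom then reduces to a
    one-line inequality about [J].  A tautology has value [\top] because any
    nonzero element of a boolean frame lies above a nonzero [x] below the value
    or its complement for each of the finitely many propositional variables of
    the formula; such an [x] acts as a truth assignment, so it cannot lie below
    the complement of the tautology. *)

Require Import Defs.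
From mathcomp Require Import all_boot all_order.
From mathcomp Require Import all_classical.

Set Implicit Arguments.
Unset Strict Implicit.
Unset Printing Implicit Defensive.

Import Order.TTheory.

Local Open Scope classical_set_scope.
Local Open Scope order_scope.

Lemma bigjoin_supremum d (X : frameType d) (A : set X) :
  supremums A (bigjoin A).
Proof.
rewrite /bigjoin /supremum; case: ifPn => [/eqP->|_].
  (* On the empty set [supremum] returns its default, and the default chosen in [bigjoin] is the
     least element, which is the empty join. *)
  by split=> [x []|x _]; exact: le0x.
by apply: xgetPex; exact: lattice_complete.
Qed.

Lemma le_bigjoin d (X : frameType d) (A : set X) (x : X) :
  A x -> x <= bigjoin A.
Proof. by have [ubA _] := bigjoin_supremum A; exact: ubA. Qed.

Lemma bigjoin_le d (X : frameType d) (A : set X) (y : X) :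
  (forall x, A x -> x <= y) -> bigjoin A <= y.
Proof. by have [_ lubA] := bigjoin_supremum A; exact: lubA. Qed.

Lemma bigmeet_le d (X : frameType d) (A : set X) (x : X) :
  A x -> bigmeet A <= x.
Proof.
have infA : infimums A !=set0.
  (* The join of all lower bounds is itself a lower bound, hence the greatest one. *)
  exists (bigjoin (lbound A)); split=> [y Ay|y]; last exact: le_bigjoin.
  by apply: bigjoin_le => z; apply.
rewrite /bigmeet /infimum; case: ifPn => [/eqP-> []|_ Ax].
by have [lbA _] := xgetPex \top infA; exact: lbA.
Qed.

(** Binary distributivity as case analysis, obtained from the infinite law for the join of the pair
    of [a] and [b]. *)
Lemma meet_join_le d (X : frameType d) (x a b y : X) :
  x `&` a <= y -> x `&` b <= y -> x `&` (a `|` b) <= y.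
Proof.
move=> xay xby; pose A : set X := [set c | c = a \/ c = b].
have abA : a `|` b <= bigjoin A.
  by rewrite leUx !le_bigjoin //; [right|left].
apply: (le_trans (leI2 (lexx x) abA)); rewrite meet_bigjoin.
by apply: bigjoin_le => _ [c [->|->] <-].
Qed.

Lemma compl_is_complement (X : modal_space) (a : X) :
  boolean X -> is_complement a (compl a).
Proof. by move=> /(_ a); exact: (@xgetPex _ \bot [set b | is_complement a b]). Qed.

Lemma meet_compl (X : modal_space) (a : X) :
  boolean X -> a `&` compl a = \bot.
Proof. by case/(compl_is_complement a). Qed.

(** Material implication is the Heyting implication: one direction distributes [a] over the join,
    the other splits [x] along [a] and its complement. *)
Lemma le_joincP (X : modal_space) (x a b : X) :
  boolean X -> x <= compl a `|` b <-> x `&` a <= b.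
Proof.
move=> bX; have [a0 a1] := compl_is_complement a bX; split => [xab|xab].
- apply: (le_trans (leI2 xab (lexx a))); rewrite meetC.
  by apply: meet_join_le; rewrite ?leIr // a0 le0x.
- rewrite -[x]meetx1 -a1; apply: meet_join_le.
    by rewrite (le_trans xab) // leUr.
  by rewrite (le_trans (leIr _ _)) // leUl.
Qed.

Lemma le_complP (X : modal_space) (x a : X) :
  boolean X -> x <= compl a <-> x `&` a = \bot.
Proof.
move=> bX; have := le_joincP x a \bot bX.
by rewrite joinx0 lex0 => ->; split => /eqP.
Qed.

Section Soundness.
Variables (atom : Type) (X : modal_space) (V : formula atom -> X).
Hypotheses (bX : boolean X) (valV : valuation V).
Implicit Types (A B : formula atom) (x y c : X).

Lemma box_adjoint c B : J c <= V B <-> c <= V (Box B).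
Proof.
rewrite (V_Box valV); split => [cB|cB]; first exact: le_bigjoin.
apply: (le_trans (J_mono cB)); rewrite J_bigjoin.
by apply: bigjoin_le => _ [b bB <-].
Qed.

Lemma J_box B : J (V (Box B)) <= V B.
Proof. exact/box_adjoint. Qed.

Lemma imp_valid A B : V (Imp A B) = \top <-> V A <= V B.
Proof.
have := le_joincP \top (V A) (V B) bX.
by rewrite (V_Imp valV) meet1x le1x => <-; split=> /eqP.
Qed.

(** A truth lemma at [y], viewed as a possible world where the true propositional variables are
    those whose value lies above [y]. *)
Definition decides y A :=
  y <= if truth (fun B => y <= V B) A then V A else compl (V A).

(* Quantifying over all nonzero [y <= x'], rather than stating this for [x']
   alone, makes the choices for two subformulas compose. *)
Definition refinable A := forall x, x != \bot ->
  exists2 x', x' <= x &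
    x' != \bot /\ forall y, y <= x' -> y != \bot -> decides y A.

Lemma truth_refinement A : refinable A.
Proof.
(* If [x] is disjoint from [V B], it already lies below the complement; otherwise its nonzero meet
   with [V B] is the refinement. *)
have var B x : x != \bot -> exists2 x', x' <= x & x' != \bot /\
    forall y, y <= x' -> y != \bot ->
      y <= if y <= V B then V B else compl (V B).
  move=> x0; have [xB|xB] := eqVneq (x `&` V B) \bot.
    exists x => //; split=> // y yx _; case: ifPn => // _.
    by apply: (le_trans yx); apply/le_complP.
  exists (x `&` V B); first exact: leIl.
  split=> // y yx _; have yB : y <= V B by apply: (le_trans yx); exact: leIr.
  by rewrite yB.
(* Refine for [B], then for [C] inside the result; decisions on [B] persist to smaller nonzero
   elements. *)
have pair B C x : refinable B -> refinable C -> x != \bot ->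
    exists2 x', x' <= x & x' != \bot /\
      forall y, y <= x' -> y != \bot -> decides y B /\ decides y C.
  move=> hB hC /hB[x1 x1x [x10 h1]]; have [x2 x21 [x20 h2]] := hC _ x10.
  exists x2; first exact: le_trans x1x.
  by split=> // y yx y0; split; [apply: h1 => //; exact: le_trans x21|exact: h2].
have compl_anti (a b : X) : a <= b -> compl b <= compl a.
  move=> ab; apply/le_complP => //; apply/eqP; rewrite -lex0.
  by rewrite -(meet_compl b bX) meetC leI2.
have compl_compl (a : X) : a <= compl (compl a).
  by apply/le_complP; rewrite ?meet_compl.
elim: A => [a|||B hB C hC|B hB C hC|B hB C hC|B hB|B _] x x0; rewrite /decides /=.
- exact: var.
- by exists x => //; split=> // y _ _; rewrite (V_Top valV) lex1.
- exists x => //; split=> // y _ _; rewrite (V_Bot valV).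
  by apply/le_complP; rewrite ?meetx0.
- have [x' x'x [x'0 h]] := pair _ _ _ hB hC x0.
  exists x' => //; split=> // y yx' y0; have [] := h y yx' y0; rewrite /decides.
  rewrite (V_And valV); case: truth => /= [yB|yB _]; last first.
    by apply: (le_trans yB); exact/compl_anti/leIl.
  case: truth => yC; first by rewrite lexI yB.
  by apply: (le_trans yC); exact/compl_anti/leIr.
- have [x' x'x [x'0 h]] := pair _ _ _ hB hC x0.
  exists x' => //; split=> // y yx' y0; have [] := h y yx' y0; rewrite /decides.
  rewrite (V_Or valV); case: truth => /= [yB _|yB].
    by apply: (le_trans yB); exact: leUl.
  case: truth => yC; first by apply: (le_trans yC); exact: leUr.
  apply/le_complP => //; apply/eqP; rewrite -lex0; apply: meet_join_le.
    by move/le_complP: yB => ->.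
  by move/le_complP: yC => ->.
- have [x' x'x [x'0 h]] := pair _ _ _ hB hC x0.
  exists x' => //; split=> // y yx' y0; have [] := h y yx' y0; rewrite /decides.
  rewrite (V_Imp valV); case: truth => /= [yB|yB _]; last first.
    by apply: (le_trans yB); exact: leUl.
  case: truth => yC; first by apply: (le_trans yC); exact: leUr.
  apply/le_complP => //; apply/eqP; rewrite -lex0; apply: meet_join_le.
    by rewrite -(meet_compl (V B) bX) leI2.
  by move/le_complP: yC => ->.
- have [x' x'x [x'0 h]] := hB x x0.
  exists x' => //; split=> // y yx' y0; have := h y yx' y0; rewrite /decides.
  rewrite (V_Neg valV); case: truth => //= yB.
  by apply: (le_trans yB); exact: compl_compl.
- exact: var.
Qed.

Lemma tautology_valid A : tautology A -> V A = \top.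
Proof.
move=> tA; have [A0 A1] := compl_is_complement (V A) bX.
have [nA|nA] := eqVneq (compl (V A)) \bot; first by rewrite -A1 nA joinx0.
have [x xA [x0 /(_ x (lexx x) x0)]] := truth_refinement A nA.
(* Being a tautology, [A] is true at [x], so [x] lies below both [V A] and its complement. *)
rewrite /decides tA => xA'; case/negP: x0.
by rewrite -lex0 -A0 lexI xA' xA.
Qed.

Lemma thm_valid (Ax : set (formula atom)) A :
  (forall B, Ax B -> V B = \top) -> thm Ax A -> V A = \top.
Proof.
move=> axV; elim=> {A} [A|A B|A|A B _ AB1 _ A1|A _ A1].
- exact: tautology_valid.
- apply/imp_valid; rewrite (V_Imp valV); apply/le_joincP => //.
  (* After transposing, monotonicity of [J] bounds the left side by the meet of [V (Imp A B)] and
     [V A], and modus ponens finishes. *)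
  apply/box_adjoint.
  apply: (@le_trans _ _ (V (Imp A B) `&` V A)).
    by rewrite lexI !(le_trans (J_mono _) (J_box _)) ?leIl ?leIr.
  by apply/le_joincP => //; rewrite (V_Imp valV).
- exact: axV.
- by move/imp_valid: AB1; rewrite A1 le1x => /eqP.
- by apply/eqP; rewrite -le1x; apply/box_adjoint; rewrite A1 lex1.
Qed.

Lemma le_conj (s : seq (formula atom)) x :
  (forall B, List.In B s -> x <= V B) -> x <= V (conj s).
Proof.
case: s => [|A s] /= hs; first by rewrite (V_Top valV) lex1.
(* The head [A] is the accumulator of the left fold, so it must vary in the induction. *)
elim: s A hs => [|B s ih] A hs /=; first by apply: hs; left.
apply: ih => C [<-|Cs]; last by apply: hs; right; right.
by rewrite (V_And valV) lexI !hs //=; [right; left|left].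
Qed.

Lemma axD_valid B : Spaces.sCoTS X -> axD B -> V B = \top.
Proof.
move=> X_sCoTS ->; have box0 : V (Box Bot) = \bot.
  by apply: X_sCoTS; apply/eqP; rewrite -lex0 -(V_Bot valV) J_box.
apply/eqP; rewrite (V_Neg valV) box0 -le1x.
by apply/le_complP; rewrite ?meetx0.
Qed.

Lemma axT_valid B : Spaces.CoTS X -> axT B -> V B = \top.
Proof.
by move=> X_CoTS [A _ <-]; apply/imp_valid; rewrite (le_trans (X_CoTS _)) ?J_box.
Qed.

Lemma ax4_valid B : Spaces.sTS X -> ax4 B -> V B = \top.
Proof.
(* Transposing both outer boxes leaves [J (J (V (Box A))) <= V A]. *)
move=> X_sTS [A _ <-]; apply/imp_valid; do 2!apply: (iffLR (box_adjoint _ _)).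
by rewrite (le_trans (X_sTS _)) ?J_box.
Qed.

End Soundness.

Lemma TS_sTS (X : modal_space) : Spaces.TS X -> Spaces.sTS X.
Proof. by move=> X_TS a; exact: X_TS. Qed.

(** Reduces each claim to the validity of its extra axioms, since the meet over [Gamma] lies below
    the value of every finite conjunction from [Gamma]. *)
Lemma soundness (atom : Type) (Ax : set (formula atom)) (C : set modal_space)
    (Gamma : set (formula atom)) (A : formula atom) :
  (forall X, C X -> forall V : formula atom -> X,
    boolean X -> valuation V -> forall B, Ax B -> V B = \top) ->
  proves (thm Ax) Gamma A -> entails (C `&` boolean)%classic Gamma A.
Proof.
move=> axV [s [sG thA]] X [CX bX] V valV.
have /(imp_valid bX valV) sA := thm_valid bX valV (axV X CX V bX valV) thA.
apply: le_trans sA; apply: le_conj => // B /sG GB.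
by apply: bigmeet_le; exists B.
Qed.

Theorem theorem4p6 (atom : Type) (Gamma : set (formula atom))
    (A : formula atom) :
  (proves (@Logic.K atom) Gamma A -> entails Spaces.bMS Gamma A) /\
  (proves (@Logic.D atom) Gamma A -> entails Spaces.bsCoTS Gamma A) /\
  (proves (@Logic.T atom) Gamma A -> entails Spaces.bCoTS Gamma A) /\
  (proves (@Logic.K4 atom) Gamma A -> entails Spaces.bsTS Gamma A) /\
  (proves (@Logic.KD4 atom) Gamma A -> entails Spaces.bsS Gamma A) /\
  (proves (@Logic.S4 atom) Gamma A -> entails Spaces.bS Gamma A).
Proof.
do 5?split; apply: soundness => X CX V bX valV B.
- by [].
- exact: axD_valid.
- exact: axT_valid.
- exact: ax4_valid.
- case: CX => X_sCoTS /TS_sTS X_sTS.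
  by case; [exact: axD_valid|exact: ax4_valid].
- case: CX => /TS_sTS X_sTS X_CoTS.
  by case; [exact: axT_valid|exact: ax4_valid].
Qed.
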